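(* Let $\Delta=(\Sigma,\beta)$ and $\Delta'=(\Sigma,\beta')$ be complete non-singular topological fans of dimension $n$ on the same simplicial complex $\Sigma$, with $\beta_i=(b_i+\sqrt{-1}c_i,v_i)$ and $\beta'_i=(b'_i+\sqrt{-1}c'_i,v'_i)$, and suppose $v_i=v'_i$ for every vertex $i$. Then $X(\Delta)$ and $X(\Delta')$ are $(S^1)^n$-equivariantly homeomorphic, where $(S^1)^n\subset(\mathbb C^* )^n$ acts by restriction.
   Context: $\mathcal R$ denotes the ring of real $2\times2$ matrices $\begin{bmatrix} b&0\\ c&v\end{bmatrix}$ with $b,c\in\mathbb R$, $v\in\mathbb Z$, identified with $\mathbb C\times\mathbb Z$ via $(b+\sqrt{-1}c,v)$; for $g\in\mathbb C^*$, $g^\mu:=|g|^{b+\sqrt{-1}c}(g/|g|)^v$, with $(g^{\mu_1})^{\mu_2}=g^{\mu_2\mu_1}$. For $\beta=(\beta^1,\dots,\beta^n)\in\mathcal R^n=\mathbb C^n\times\mathbb Z^n$, $\lambda_\beta(g)=(g^{\beta^1},\dots,g^{\beta^n})$, and $\langle\alpha,\beta\rangle=\sum_k\alpha^k\beta^k$. A topological fan of dimension $n$ is $(\Sigma,\beta)$, $\Sigma$ an abstract finite simplicial complex of dimension $n-1$ with vertex set $[m]$, $\beta:[m]\to\mathcal R^n$, $\beta_i=(b_i+\sqrt{-1}c_i,v_i)$, such that the cones $\angle b_I$ spanned by $\{b_i\}_{i\in I}$, $I\in\Sigma$, are simplicial (the $b_i$, $i\in I$, linearly independent) with $\angle b_I\cap\angle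 b_J=\angle b_{I\cap J}$, and each $v_i$ is primitive with $\{v_i\}_{i\in I}$ linearly independent for $I\in\Sigma$. Complete: $\bigcup_{I}\angle b_I=\mathbb R^n$. Non-singular: $\{v_i\}_{i\in I}$ is part of a $\mathbb Z$-basis for each $I\in\Sigma$. $X(\Delta)$: with $U(I)=\{z\in\mathbb C^m:z_i\ne0\ \forall i\notin I\}$, $U(\Sigma)=\bigcup_{I\in\Sigma}U(I)$, $\lambda:(\mathbb C^* )^m\to(\mathbb C^* )^n$, $\lambda(h)=\prod_k\lambda_{\beta_k}(h_k)$, set $X(\Delta)=U(\Sigma)/\ker\lambda$ with the action of $(\mathbb C^* )^m/\ker\lambda\cong(\mathbb C^* )^n$ (via $\lambda$) induced by coordinatewise multiplication. *)

(* Defs.v *)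
From HB Require Import structures.
From mathcomp Require Import all_boot all_order all_algebra.
From mathcomp Require Import all_classical all_reals.
From mathcomp Require Import sequences exp trigo.
From mathcomp.real_closed Require Import complex.

Set Implicit Arguments.
Unset Strict Implicit.
Unset Printing Implicit Defensive.

Import Order.TTheory GRing.Theory Num.Theory.
Local Open Scope ring_scope.

Definition cabs (R : realType) (g : R[i]) : R :=
  Num.sqrt (complex.Re g ^+ 2 + complex.Im g ^+ 2).

(* g^mu for mu = (b + sqrt(-1) c, v) in R = C x Z :
   g^mu = |g|^(b + sqrt(-1) c) (g/|g|)^v
        = exp((b + sqrt(-1) c) ln|g|) (g/|g|)^v *)
Definition cpow (R : realType) (g : R[i]) (b c : R) (v : int) : R[i] :=
  let L := ln (cabs g) in
  Complex (expR (b * L)) 0 * Complex (cos (c * L)) (sin (c * L))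
  * (g / Complex (cabs g) 0) ^ v.

(* ---------- topological fans ----------
   A fan of dimension n with vertex set [m] = 'I_m is given by
   Sigma : {set {set 'I_m}} and beta_i = (b_i + sqrt(-1) c_i, v_i)
   with b i, c i : R^n (as 'I_n -> R) and v i : Z^n (as 'I_n -> int). *)

Definition simplicial_complex_dim (m n : nat) (Sigma : {set {set 'I_m}}) : Prop :=
  [/\ (finset.set0 : {set 'I_m}) \in Sigma,
      (forall I J : {set 'I_m}, I \in Sigma -> J \subset I -> J \in Sigma),
      (forall i : 'I_m, [set i]%SET \in Sigma),
      (forall I : {set 'I_m}, I \in Sigma -> (#|I| <= n)%N)
    & (exists I : {set 'I_m}, I \in Sigma /\ #|I| = n)].

Definition cone (R : realType) (m n : nat) (b : 'I_m -> 'I_n -> R)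
    (I : {set 'I_m}) : set ('I_n -> R) :=
  [set x | exists t : 'I_m -> R, (forall i, 0 <= t i) /\
           forall k, x k = \sum_(i in I) t i * b i k].

Definition lin_indep_R (R : realType) (m n : nat) (b : 'I_m -> 'I_n -> R)
    (I : {set 'I_m}) : Prop :=
  forall a : 'I_m -> R, (forall k, \sum_(i in I) a i * b i k = 0) ->
  forall i, i \in I -> a i = 0.

Definition lin_indep_Z (m n : nat) (v : 'I_m -> 'I_n -> int)
    (I : {set 'I_m}) : Prop :=
  forall a : 'I_m -> int, (forall k, \sum_(i in I) a i * v i k = 0) ->
  forall i, i \in I -> a i = 0.

Definition primitive (n : nat) (u : 'I_n -> int) : Prop :=
  (exists k, u k != 0) /\
  forall (d : int) (w : 'I_n -> int), (forall k, u k = d * w k) ->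
  d = 1 \/ d = -1.

Definition Zbasis (n : nat) (w : 'I_n -> 'I_n -> int) : Prop :=
  (forall x : 'I_n -> int, exists a : 'I_n -> int,
      forall k, x k = \sum_(j < n) a j * w j k) /\
  (forall a : 'I_n -> int, (forall k, \sum_(j < n) a j * w j k = 0) ->
      forall j, a j = 0).

Definition topological_fan (R : realType) (m n : nat) (Sigma : {set {set 'I_m}})
    (b c : 'I_m -> 'I_n -> R) (v : 'I_m -> 'I_n -> int) : Prop :=
  [/\ simplicial_complex_dim n Sigma,
      (forall I, I \in Sigma -> lin_indep_R b I),
      (forall I J, I \in Sigma -> J \in Sigma ->
          (cone b I `&` cone b J)%classic = cone b (I :&: J)),
      (forall i, primitive (v i))
    & (forall I, I \in Sigma -> lin_indep_Z v I)].

Definition complete_fan (R : realType) (m n : nat) (Sigma : {set {set 'I_m}})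
    (b : 'I_m -> 'I_n -> R) : Prop :=
  forall x : 'I_n -> R, exists I, I \in Sigma /\ cone b I x.

Definition nonsingular_fan (m n : nat) (Sigma : {set {set 'I_m}})
    (v : 'I_m -> 'I_n -> int) : Prop :=
  forall I, I \in Sigma -> exists w : 'I_n -> 'I_n -> int, Zbasis w /\
    exists f : 'I_m -> 'I_n, {in I &, injective f} /\
      forall i, i \in I -> forall k, w (f i) k = v i k.

Definition complete_nonsingular_fan (R : realType) (m n : nat)
    (Sigma : {set {set 'I_m}}) (b c : 'I_m -> 'I_n -> R)
    (v : 'I_m -> 'I_n -> int) : Prop :=
  [/\ topological_fan Sigma b c v, complete_fan Sigma b & nonsingular_fan Sigma v].

Definition Uset (R : realType) (m : nat) (Sigma : {set {set 'I_m}}) :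
    set ('I_m -> R[i]) :=
  [set z | exists I, I \in Sigma /\ forall i, i \notin I -> z i != 0].

Definition lam (R : realType) (m n : nat) (b c : 'I_m -> 'I_n -> R)
    (v : 'I_m -> 'I_n -> int) (h : 'I_m -> R[i]) : 'I_n -> R[i] :=
  fun k => \prod_(i < m) cpow (h i) (b i k) (c i k) (v i k).

Definition kerlam (R : realType) (m n : nat) (b c : 'I_m -> 'I_n -> R)
    (v : 'I_m -> 'I_n -> int) : set ('I_m -> R[i]) :=
  [set h | (forall i, h i != 0) /\ forall k, lam b c v h k = 1].

Definition orbit (R : realType) (m n : nat) (b c : 'I_m -> 'I_n -> R)
    (v : 'I_m -> 'I_n -> int) (z : 'I_m -> R[i]) : set ('I_m -> R[i]) :=
  [set w | exists h, kerlam b c v h /\ forall i, w i = h i * z i].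

Definition Xspace (R : realType) (m n : nat) (Sigma : {set {set 'I_m}})
    (b c : 'I_m -> 'I_n -> R) (v : 'I_m -> 'I_n -> int) :
    set (set ('I_m -> R[i])) :=
  [set O | exists z, @Uset R m Sigma z /\ O = orbit b c v z].

Definition open_in_C (R : realType) (m : nat) (U S : set ('I_m -> R[i])) : Prop :=
  forall z, S z -> exists e : R, 0 < e /\
    forall w, U w -> (forall i, cabs (w i - z i) < e) -> S w.

(* quotient topology on X(Delta): a set A of orbits is open iff
   its preimage (the union of its orbits) is open in U(Sigma) *)
Definition Xopen (R : realType) (m : nat) (Sigma : {set {set 'I_m}})
    (A : set (set ('I_m -> R[i]))) : Prop :=
  open_in_C (@Uset R m Sigma) (\bigcup_(O in A) O)%classic.

(* the action of t in (C^* )^n (identified with (C^* )^m / ker lambda via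
   lambda) on X(Delta): t . [z] = [h z] for any h with lambda(h) = t.
   act t x y  means  t . x = y. *)
Definition Xact (R : realType) (m n : nat) (b c : 'I_m -> 'I_n -> R)
    (v : 'I_m -> 'I_n -> int) (t : 'I_n -> R[i])
    (x y : set ('I_m -> R[i])) : Prop :=
  exists z h, x z /\ (forall i, h i != 0) /\ (forall k, lam b c v h k = t k) /\
    y = orbit b c v (fun i => h i * z i).

Definition torus (R : realType) (n : nat) : set ('I_n -> R[i]) :=
  [set t | forall k, cabs (t k) = 1].

(* Main.v *)
(* Let Z be the moment-angle complex: the z with |z_i| <= 1 for which {i : |z_i| < 1} is
   a simplex.  Completeness and the fan property say that each p in R^n has unique
   nonnegative coordinates T p, supported on a simplex, with p = sum_i (T p)_i b_i;
   T is continuous.  The moduli of elements of ker lambda are the exp x with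
   sum_i x_i b_i = 0, and as the v_i of a top simplex form a basis of Z^n, every such x
   is realised by an element of ker lambda.  Replacing -log |z| by T (sum_i -log |z_i| b_i)
   moves z into Z along its ker lambda-orbit, and two points of Z on one orbit differ by an
   element with all moduli 1.  On such elements lambda depends on the v_i only, so Z meets
   the orbits of both fans in the same sets, and sending the orbit of z in Z for one fan to
   its orbit for the other is the required homeomorphism. *)
Require Import Defs.
From HB Require Import structures.
From mathcomp Require Import all_boot all_order all_algebra.
From mathcomp Require Import all_classical all_reals.
From mathcomp Require Import topology normedtype sequences exp trigo realfun.
From mathcomp Require Import ring.
From mathcomp.real_closed Require Import complex.
Import Order.TTheory GRing.Theory Num.Theory.
Import numFieldNormedType.Exports.
Local Open Scope ring_scope.
Local Open Scope classical_set_scope.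

Set Implicit Arguments.
Unset Strict Implicit.
Unset Printing Implicit Defensive.

Local Notation orbit := Defs.orbit.

(** * Complex powers in logarithmic polar coordinates *)

Section ComplexPowers.
Variable R : realType.
Implicit Types (g h : R[i]) (x y theta eta : R).

Lemma cabsE g : cabs g = ComplexField.Normc.normc g.
Proof. by case: g. Qed.

Lemma cabs0 : cabs (0 : R[i]) = 0.
Proof. by rewrite cabsE ComplexField.Normc.normc0. Qed.

Lemma cabs_ge0 g : 0 <= cabs g.
Proof. exact: sqrtr_ge0. Qed.

Lemma cabs_eq0 g : (cabs g == 0) = (g == 0).
Proof.
apply/eqP/eqP => [|->]; last exact: cabs0.
by rewrite cabsE => /ComplexField.Normc.eq0_normc.
Qed.

Lemma cabs_gt0 g : (0 < cabs g) = (g != 0).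
Proof. by rewrite lt_def cabs_eq0 cabs_ge0 andbT. Qed.

Lemma cabsM g h : cabs (g * h) = cabs g * cabs h.
Proof. by rewrite !cabsE ComplexField.Normc.normcM. Qed.

Lemma cabsV g : cabs g^-1 = (cabs g)^-1.
Proof. by rewrite !cabsE ComplexField.Normc.normcV. Qed.

Lemma cabs_prod (I : finType) (f : I -> R[i]) :
  cabs (\prod_i f i) = \prod_i cabs (f i).
Proof.
apply: (big_morph _ cabsM).
by rewrite cabsE ComplexField.Normc.normc1.
Qed.

Lemma normr_Re_le_cabs g : `|complex.Re g| <= cabs g.
Proof. by rewrite -sqrtr_sqr ler_wsqrtr // lerDl sqr_ge0. Qed.

Lemma normr_Im_le_cabs g : `|complex.Im g| <= cabs g.
Proof. by rewrite -sqrtr_sqr ler_wsqrtr // lerDr sqr_ge0. Qed.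

(** The exponential of [x + sqrt(-1) * theta]; the first argument is the log-modulus. *)
Definition polar x theta : R[i] := Complex (expR x * cos theta) (expR x * sin theta).

Lemma polarD x y theta eta :
  polar (x + y) (theta + eta) = polar x theta * polar y eta.
Proof.
rewrite /polar expRD cosD sinD.
rewrite -[RHS]/(Complex (_ - _) (_ + _)); congr Complex; ring.
Qed.

Lemma polar0 : polar 0 0 = 1.
Proof. by rewrite /polar expR0 cos0 sin0 mulr1 mulr0. Qed.

Lemma cabs_polar x theta : cabs (polar x theta) = expR x.
Proof.
rewrite /cabs /= !exprMn -mulrDr cos2Dsin2 mulr1 sqrtr_sqr ger0_norm //.
exact: expR_ge0.
Qed.

Lemma polar_neq0 x theta : polar x theta != 0.
Proof. by rewrite -cabs_gt0 cabs_polar expR_gt0. Qed.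

Lemma polarN x theta : polar (- x) (- theta) = (polar x theta)^-1.
Proof.
apply: (mulfI (polar_neq0 x theta)).
by rewrite -polarD !subrr polar0 divff ?polar_neq0.
Qed.

Lemma polarX theta (k : nat) : polar 0 theta ^+ k = polar 0 (k%:R * theta).
Proof.
elim: k => [|k IH]; first by rewrite expr0 mul0r polar0.
by rewrite exprS IH -polarD addr0 -[k.+1]add1n natrD mulrDl mul1r.
Qed.

Lemma polarXz theta (k : int) : polar 0 theta ^ k = polar 0 (k%:~R * theta).
Proof.
case: k => k; first by rewrite -exprnP polarX.
by rewrite NegzE -exprz_inv -exprnP -polarN oppr0 polarX intrN mulrN mulNr.
Qed.

Lemma cpowE g (b c : R) (v : int) :
  cpow g b c v = polar (b * ln (cabs g)) (c * ln (cabs g))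
                 * (g / Complex (cabs g) 0) ^ v.
Proof.
rewrite /cpow; congr (_ * _); rewrite /polar -[LHS]/(Complex (_ - _) (_ + _)).
by congr Complex; rewrite !mul0r ?subr0 ?addr0.
Qed.

Lemma cpowM g h (b c : R) (v : int) : g != 0 -> h != 0 ->
  cpow (g * h) b c v = cpow g b c v * cpow h b c v.
Proof.
move=> g0 h0; rewrite !cpowE cabsM lnM ?posrE ?cabs_gt0 // !mulrDr polarD.
rewrite [RHS]mulrACA -exprMz_comm; last first.
  exact: mulrC.
- by rewrite unitfE mulf_neq0 ?invr_neq0 // eq_complex /= cabs_eq0 (negPf h0).
- by rewrite unitfE mulf_neq0 ?invr_neq0 // eq_complex /= cabs_eq0 (negPf g0).
congr (_ * _ ^ _); rewrite mulrACA -invfM; congr (_ * _^-1).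
rewrite -[RHS]/(Complex (_ - _) (_ + _)); congr Complex.
  by rewrite mul0r subr0.
by rewrite mulr0 mul0r addr0.
Qed.

(** The exponent acts as the matrix with rows [(b, 0)] and [(c, v)] on the column [(x, theta)],
    which makes the equations of ker lambda linear. *)
Lemma cpow_polar x theta (b c : R) (v : int) :
  cpow (polar x theta) b c v = polar (b * x) (c * x + v%:~R * theta).
Proof.
rewrite cpowE cabs_polar expRK.
have -> : Complex (expR x) 0 = polar x 0 by rewrite /polar cos0 sin0 mulr1 mulr0.
by rewrite -polarN -polarD subrr oppr0 addr0 polarXz -polarD addr0.
Qed.

Lemma cabs_normalized g : g != 0 -> cabs (g / Complex (cabs g) 0) = 1.
Proof.
move=> g0; rewrite cabsM cabsV /cabs /= expr0n addr0 sqrtr_sqr.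
rewrite -/(cabs g) ger0_norm ?cabs_ge0 // divff // cabs_eq0 //.
Qed.

Lemma cabsXz g (v : int) : cabs g = 1 -> cabs (g ^ v) = 1.
Proof.
have X k : cabs g = 1 -> cabs (g ^+ k) = 1.
  move=> g1; elim: k => [|k IH]; last by rewrite exprS cabsM g1 IH mulr1.
  by rewrite expr0 cabsE ComplexField.Normc.normc1.
by case: v => k g1; rewrite /exprz ?cabsV X // invr1.
Qed.

Lemma cabs_cpow g (b c : R) (v : int) : g != 0 ->
  cabs (cpow g b c v) = expR (b * ln (cabs g)).
Proof.
move=> g0; rewrite cpowE cabsM cabs_polar cabsXz ?mulr1 //.
exact: cabs_normalized.
Qed.

(** [b] and [c] enter only as multiples of [ln (cabs g)], which vanishes here. This is what makes
    two fans with the same [v] comparable. *)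
Lemma cpow_unit g (b c b' c' : R) (v : int) : cabs g = 1 ->
  cpow g b c v = cpow g b' c' v.
Proof. by move=> g1; rewrite !cpowE g1 ln1 !mulr0. Qed.

End ComplexPowers.

(** * Nonnegative coordinates of points of R^n along a simplicial fan, and their continuity *)

Section FanCoordinates.
Variables (R : realType) (m n : nat) (Sigma : {set {set 'I_m}}).
Variable b : 'I_m -> 'I_n -> R.

(** Coordinates are indexed by all vertices and padded by zero off a simplex, so that vectors
    carried by different cones can be compared and subtracted. *)
Definition fan_coord (p : 'I_n -> R) (t : 'I_m -> R) : Prop :=
  [/\ forall i, 0 <= t i,
      exists2 I, I \in Sigma & forall i, i \notin I -> t i = 0
    & forall k, p k = \sum_i t i * b i k].

Lemma sum_supp (I : {set 'I_m}) (t : 'I_m -> R) k :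
  (forall i, i \notin I -> t i = 0) ->
  \sum_i t i * b i k = \sum_(i in I) t i * b i k.
Proof.
move=> tI; rewrite [LHS](bigID (mem I)) /= [X in _ + X]big1 ?addr0 // => i iI.
by rewrite tI ?mul0r.
Qed.

Lemma lin_indep_eq (I : {set 'I_m}) (s t : 'I_m -> R) : lin_indep_R b I ->
  (forall k, \sum_(i in I) s i * b i k = \sum_(i in I) t i * b i k) ->
  forall i, i \in I -> s i = t i.
Proof.
move=> indI st i iI; apply/eqP; rewrite -subr_eq0; apply/eqP.
apply: (indI (fun i => s i - t i)) => // k; apply/eqP.
rewrite (eq_bigr (fun i => s i * b i k - t i * b i k)); last by move=> j _; rewrite mulrBl.
by rewrite sumrB st subrr.
Qed.

(** Supplies, for each cone, a matrix [B] that reads the coordinates off the point linearly;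
    continuity of the fan coordinates rests on it. *)
Lemma lin_indep_left_inverse (I : {set 'I_m}) : lin_indep_R b I ->
  exists B : 'I_n -> 'I_m -> R, forall t : 'I_m -> R,
    (forall i, i \notin I -> t i = 0) ->
    forall i, t i = \sum_k (\sum_j t j * b j k) * B k i.
Proof.
move=> indI.
pose Ml : 'M[R]_(m, n) := \matrix_(i, k) b i k.
(* The extra columns force the coordinates outside [I] to vanish. *)
pose Mr : 'M[R]_(m, m) := diag_mx (\row_i (i \notin I)%:R).
have MrE (t : 'rV[R]_m) i : (t *m Mr) 0 i = t 0 i * (i \notin I)%:R.
  by rewrite mul_mx_diag !mxE.
have /row_freeP[B MB] : row_free (row_mx Ml Mr).
  apply: inj_row_free => t; rewrite mul_mx_row -[0]row_mx0 => /eq_row_mx[tl tr].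
  have tI i : i \notin I -> t 0 i = 0.
    by move=> iI; move/rowP/(_ i): tr; rewrite MrE iI mulr1 mxE.
  apply/rowP => i; rewrite mxE; have [iI|/tI//] := boolP (i \in I).
  apply: (indI (t 0)) => // k; rewrite -sum_supp //.
  move/rowP/(_ k): tl; rewrite !mxE => tl; rewrite -[RHS]tl.
  by apply: eq_bigr => j _; rewrite mxE.
exists (fun k i => B (lshift m k) i) => t tI i.
pose u : 'rV[R]_m := \row_i t i.
have -> : t i = (u *m (row_mx Ml Mr *m B)) 0 i by rewrite MB mulmx1 mxE.
rewrite mulmxA mul_mx_row mxE big_split_ord /= [X in _ + X]big1 ?addr0 => [|k _].
  apply: eq_bigr => k _; rewrite row_mxEl !mxE; congr (_ * _).
  by apply: eq_bigr => j _; rewrite !mxE.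
rewrite row_mxEr MrE mxE; have [kI|/tI->] := boolP (k \in I).
  by rewrite mulr0 mul0r.
by rewrite !mul0r.
Qed.

Hypothesis indep : forall I, I \in Sigma -> lin_indep_R b I.
Hypothesis coneI : forall I J, I \in Sigma -> J \in Sigma ->
  (cone b I `&` cone b J)%classic = cone b (I :&: J).

Lemma fan_coord_cone (I : {set 'I_m}) p t : fan_coord p t ->
  (forall i, i \notin I -> t i = 0) -> cone b I p.
Proof.
move=> [t0 _ tp] tI; exists t; split=> // k.
by rewrite tp (sum_supp _ tI).
Qed.

(** A point of two cones lies in the cone of their common face; its coordinates there, padded by
    zero, agree with both vectors by linear independence. *)
Lemma fan_coord_uniq p s t : fan_coord p s -> fan_coord p t -> forall i, s i = t i.
Proof.
move=> sp tp; have [_ [I IS sI] sE] := sp; have [_ [J JS tJ] tE] := tp.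
have [] : (cone b I `&` cone b J)%classic p.
  by split; [exact: (fan_coord_cone sp)|exact: (fan_coord_cone tp)].
have : (cone b I `&` cone b J)%classic p.
  by split; [exact: (fan_coord_cone sp)|exact: (fan_coord_cone tp)].
rewrite coneI // => -[r [r0 rE]] _ _.
pose r' i := if i \in (I :&: J)%SET then r i else 0.
have r'IJ i : i \notin (I :&: J)%SET -> r' i = 0 by rewrite /r' => /negPf->.
have r'E k : p k = \sum_i r' i * b i k.
  by rewrite (sum_supp _ r'IJ) rE; apply: eq_bigr => i iIJ; rewrite /r' iIJ.
have eqr (K : {set 'I_m}) u : K \in Sigma -> (I :&: J \subset K)%SET ->
    (forall i, i \notin K -> u i = 0) -> (forall k, p k = \sum_i u i * b i k) ->
    forall i, u i = r' i.
  move=> KS IJK uK uE i; have r'K j : j \notin K -> r' j = 0.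
    by move=> jK; apply: r'IJ; apply: contra jK; exact: (fintype.subsetP IJK).
  have [iK|iK] := boolP (i \in K); last by rewrite uK // r'K.
  by apply: (lin_indep_eq (indep KS)) => // k; rewrite -!sum_supp // -uE r'E.
by move=> i; rewrite (eqr I s) ?finset.subsetIl// (eqr J t) ?finset.subsetIr.
Qed.

Lemma complete_fan_coord : complete_fan Sigma b ->
  exists T : ('I_n -> R) -> 'I_m -> R, forall p, fan_coord p (T p).
Proof.
move=> compl; have ex p : exists t, fan_coord p t.
  have [I [IS [t [t0 tE]]]] := compl p.
  pose t' i := if i \in I then t i else 0.
  have t'I i : i \notin I -> t' i = 0 by rewrite /t' => /negPf->.
  exists t'; split=> [i||k]; [by rewrite /t'; case: ifP|by exists I|].
  by rewrite (sum_supp _ t'I) tE; apply: eq_bigr => i iI; rewrite /t' iI.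
by have [T TP] := boolp.choice ex; exists T.
Qed.

Lemma fan_coordZ p t a : 0 <= a -> fan_coord p t ->
  fan_coord (fun k => a * p k) (fun i => a * t i).
Proof.
move=> a0 [t0 [I IS tI] tE]; split=> [i||k]; first exact: mulr_ge0.
  by exists I => // i iI; rewrite tI ?mulr0.
by rewrite tE mulr_sumr; apply: eq_bigr => i _; rewrite mulrA.
Qed.

Lemma cvgr_sum (X : Type) (F : set_system X) {FF : Filter F} (I : Type) (r : seq I)
    (P : pred I) (f : I -> X -> R) (l : I -> R) :
  (forall i, P i -> f i x @[x --> F] --> l i) ->
  \sum_(i <- r | P i) f i x @[x --> F] --> \sum_(i <- r | P i) l i.
Proof. by move=> fl; apply: cvg_big => //; exact: add_continuous. Qed.

(* On each of the finitely many cones, which are closed, the coordinates are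
   the restriction of a linear map. *)
Lemma fan_coord_cvg (T : ('I_n -> R) -> 'I_m -> R) (X : Type) (F : set_system X)
    {FF : Filter F} (p : X -> 'I_n -> R) (p0 : 'I_n -> R) :
  (forall q, fan_coord q (T q)) -> (forall k, p x k @[x --> F] --> p0 k) ->
  forall i, T (p x) i @[x --> F] --> T p0 i.
Proof.
move=> TP pp0 i; apply/cvgrPdist_lt => e e0.
(* There are finitely many [I], and each [T (p x)] is supported on one in [Sigma], so the estimates
   for fixed [I] can be intersected. *)
suff loc (I : {set 'I_m}) : \forall x \near F, I \in Sigma ->
    (forall j, j \notin I -> T (p x) j = 0) -> `|T p0 i - T (p x) i| < e.
  have := filter_forall FF loc; apply: filterS => x locx.
  by have [_ [I IS TI] _] := TP (p x); exact: (locx I).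
have [IS|_] := boolP (I \in Sigma); last by near=> x.
have [B BP] := lin_indep_left_inverse (indep IS).
pose l q j := \sum_k q k * B k j.
have lE q : (forall j, j \notin I -> T q j = 0) -> T q = l q.
  move=> TI; apply/funext => j; rewrite (BP _ TI) /l.
  by apply: eq_bigr => k _; have [_ _ ->] := TP q.
have lcvg j : l (p x) j @[x --> F] --> l p0 j.
  by apply: cvgr_sum => k _; apply: cvgM => //; exact: cvg_cst.
have [TI|/existsNP[j /not_implyP[jI Tj]]] :=
    pselect (forall j, j \notin I -> T p0 j = 0).
  have := lcvg i; move/cvgrPdist_lt/(_ e e0); apply: filterS => x + _ TxI.
  by rewrite (lE _ TxI) (lE _ TI).
suff : \forall x \near F, ~ (forall j, j \notin I -> T (p x) j = 0).
  by apply: filterS => x + _ TxI => /(_ TxI).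
(* Since [T p0] is not supported on [I], uniqueness prevents [l p0] from being the coordinates of
   [p0]: nonnegativity, support in [I] or reproduction of [p0] fails. Each is a closed condition, so
   the failing one fails eventually along [p x] as well. *)
have [l0|/existsNP[h /negP]] := pselect (forall h, 0 <= l p0 h); last first.
  rewrite -ltNge => lh.
  have : \forall x \near F, l (p x) h < 0 by exact: cvgr_lt (lcvg h) _ lh.
  apply: filterS => x lxh TxI.
  by have [/(_ h)] := TP (p x); rewrite lE // leNgt lxh.
have [lI|/existsNP[h /not_implyP[hI /eqP lh]]] :=
    pselect (forall h, h \notin I -> l p0 h = 0); last first.
  have : \forall x \near F, l (p x) h != 0 by exact: cvgr_neq0 (lcvg h) lh.
  apply: filterS => x /eqP lxh TxI.
  by apply: lxh; rewrite -lE // TxI.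
have [lp|/existsNP[k /eqP lp]] :=
    pselect (forall k, p0 k = \sum_h l p0 h * b h k).
  have lfan : fan_coord p0 (l p0) by split=> //; exists I.
  by exfalso; apply: Tj; rewrite (fan_coord_uniq (TP p0) lfan) lI.
have dcvg : p x k - \sum_h l (p x) h * b h k @[x --> F] -->
    p0 k - \sum_h l p0 h * b h k.
  apply: cvgB => //; apply: cvgr_sum => h _.
  by apply: cvgM => //; exact: cvg_cst.
rewrite -subr_eq0 in lp.
have : \forall x \near F, p x k - \sum_h l (p x) h * b h k != 0.
  exact: cvgr_neq0 dcvg lp.
apply: filterS => x /eqP dx TxI; apply: dx.
by rewrite -lE //; have [_ _ <-] := TP (p x); rewrite subrr.
Unshelve. all: by end_near. Qed.

(* By homogeneity, T (q + N b_I) = N T (q / N + b_I), and T b_I is positive on I. *)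
Lemma fan_coord_star (T : ('I_n -> R) -> 'I_m -> R) (I : {set 'I_m}) (q : 'I_n -> R) :
  (forall q, fan_coord q (T q)) -> I \in Sigma ->
  exists N, forall i, i \in I -> 0 < T (fun k => q k + N * \sum_(j in I) b j k) i.
Proof.
move=> TP IS; pose bI k := \sum_(j in I) b j k.
have bIP : fan_coord bI (fun i => (i \in I)%:R).
  split=> [i||k]; first exact: ler0n.
    by exists I => // i /negPf->.
  rewrite (@sum_supp I) => [|i /negPf-> //].
  by apply: eq_bigr => i ->; rewrite mul1r.
have qcvg k : e * q k + bI k @[e --> 0^'+] --> bI k.
  rewrite -[X in _ --> X]add0r -[X in _ --> X + _](mul0r (q k)).
  apply: cvgD; last exact: cvg_cst.
  apply: cvgM; last exact: cvg_cst.
  exact: cvg_at_right_filter.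
have Tcvg i : T (fun k => e * q k + bI k) i @[e --> 0^'+] --> T bI i.
  exact: fan_coord_cvg.
have : \forall e \near (0 : R)^'+, forall i, i \in I ->
    0 < T (fun k => e * q k + bI k) i.
  apply: filter_forall => i; have [iI|_] := boolP (i \in I); last by near=> e.
  have T0 : 0 < T bI i by rewrite (fan_coord_uniq (TP _) bIP) iI ltr01.
  have : \forall e \near (0 : R)^'+, 0 < T (fun k => e * q k + bI k) i.
    exact: cvgr_gt (Tcvg i) _ T0.
  exact: filterS.
move=> Tpos; have [e [e0 eT]] : exists e : R, 0 < e /\ forall i, i \in I ->
    0 < T (fun k => e * q k + bI k) i.
  near (0 : R)^'+ => e; exists e; split=> //.
  by near: e.
exists e^-1 => i iI.
have sE : (fun k => e^-1 * (e * q k + bI k)) = (fun k => q k + e^-1 * bI k).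
  by apply/funext => k; rewrite mulrDr mulrA mulVf ?mul1r ?gt_eqF.
have ep : 0 <= e^-1 by rewrite invr_ge0 ltW.
have := fan_coordZ ep (TP (fun k => e * q k + bI k)); rewrite sE => sP.
by rewrite (fan_coord_uniq (TP _) sP) mulr_gt0 ?invr_gt0 ?eT.
Unshelve. all: by end_near. Qed.

End FanCoordinates.

(** * The kernel of lambda and its orbits *)

Section Kernel.
Variables (R : realType) (m n : nat).
Variables (b c : 'I_m -> 'I_n -> R) (v : 'I_m -> 'I_n -> int).
Implicit Types (g h z w : 'I_m -> R[i]) (x : 'I_m -> R).

Lemma lamM g h k : (forall i, g i != 0) -> (forall i, h i != 0) ->
  lam b c v (fun i => g i * h i) k = lam b c v g k * lam b c v h k.
Proof.
by move=> g0 h0; rewrite /lam -big_split; apply: eq_bigr => i _; exact: cpowM.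
Qed.

Lemma lam_polar x (theta : 'I_m -> R) k :
  lam b c v (fun i => polar (x i) (theta i)) k =
  polar (\sum_i x i * b i k) (\sum_i (c i k * x i + (v i k)%:~R * theta i)).
Proof.
rewrite /lam; elim/big_rec3: _ => [|i y1 y2 y3 _ ->]; first by rewrite polar0.
by rewrite cpow_polar polarD mulrC [x i * _]mulrC mulrC.
Qed.

Lemma cabs_lam h k : (forall i, h i != 0) ->
  cabs (lam b c v h k) = expR (\sum_i ln (cabs (h i)) * b i k).
Proof.
move=> h0; rewrite /lam cabs_prod expR_sum; apply: eq_bigr => i _.
by rewrite cabs_cpow // mulrC.
Qed.

Lemma lam_unitary_log h : (forall i, h i != 0) ->
  (forall k, cabs (lam b c v h k) = 1) ->
  forall k, \sum_i ln (cabs (h i)) * b i k = 0.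
Proof. by move=> h0 h1 k; apply: expR_inj; rewrite -cabs_lam // h1 expR0. Qed.

Lemma cabs_unitary_neq0 h : (forall i, cabs (h i) = 1) -> forall i, h i != 0.
Proof. by move=> h1 i; rewrite -cabs_gt0 h1 ltr01. Qed.

Lemma kerlam_log h : kerlam b c v h ->
  forall k, \sum_i ln (cabs (h i)) * b i k = 0.
Proof.
move=> [h0 h1]; apply: lam_unitary_log => // k.
by rewrite h1 cabsE ComplexField.Normc.normc1.
Qed.

Lemma kerlam1 : kerlam b c v (fun=> 1).
Proof.
split=> [i|k]; first exact: oner_neq0.
rewrite /lam big1 // => i _.
by rewrite -(polar0 R) cpow_polar !mulr0 addr0 polar0.
Qed.

Lemma kerlamM g h : kerlam b c v g -> kerlam b c v h ->
  kerlam b c v (fun i => g i * h i).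
Proof.
move=> [g0 g1] [h0 h1]; split=> [i|k]; first by rewrite mulf_neq0.
by rewrite lamM // g1 h1 mulr1.
Qed.

Lemma kerlamV h : kerlam b c v h -> kerlam b c v (fun i => (h i)^-1).
Proof.
move=> [h0 h1]; have h0' i : (h i)^-1 != 0 by rewrite invr_eq0.
split=> // k; rewrite -[LHS]mul1r -(h1 k) -lamM //.
rewrite (_ : (fun i => h i * (h i)^-1) = fun=> 1); first by have [_ ->] := kerlam1.
by apply/funext => i; rewrite divff.
Qed.

Lemma orbit_refl z : orbit b c v z z.
Proof.
exists (fun=> 1); split; first exact: kerlam1.
by move=> i; rewrite mul1r.
Qed.

Lemma orbit_sym z w : orbit b c v z w -> orbit b c v w z.
Proof.
move=> [h [hK wE]]; exists (fun i => (h i)^-1); split; first exact: kerlamV.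
by move=> i; rewrite wE mulKf //; have [/(_ i)] := hK.
Qed.

Lemma orbit_trans y z w : orbit b c v y z -> orbit b c v z w -> orbit b c v y w.
Proof.
move=> [g [gK zE]] [h [hK wE]]; exists (fun i => h i * g i).
by split; [exact: kerlamM|move=> i; rewrite wE zE mulrA].
Qed.

Lemma orbit_eq z w : orbit b c v z w -> orbit b c v z = orbit b c v w.
Proof.
move=> zw; apply/seteqP; split=> y; apply: orbit_trans => //.
exact: orbit_sym.
Qed.

Lemma orbit_mul h z w : orbit b c v z w ->
  orbit b c v (fun i => h i * z i) = orbit b c v (fun i => h i * w i).
Proof.
move=> [g [gK wE]]; apply: orbit_eq; exists g; split=> // i.
by rewrite wE mulrCA.
Qed.

(* [D] solves the linear system that prescribes the phase of a kernel element
   in terms of its moduli. *)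
Lemma kerlam_phase (D : 'I_m -> 'I_n -> R) x :
  (forall l k, \sum_i (v i l)%:~R * D i k = (l == k)%:R) ->
  (forall k, \sum_i x i * b i k = 0) ->
  kerlam b c v (fun i => polar (x i) (- \sum_k D i k * \sum_j c j k * x j)).
Proof.
move=> DP x0; split=> [i|l]; first exact: polar_neq0.
rewrite lam_polar x0 big_split /= (_ : _ + _ = 0) ?polar0 //.
rewrite [X in _ + X](eq_bigr (fun i => - \sum_k (v i l)%:~R * D i k *
    \sum_j c j k * x j)); last first.
  move=> i _; rewrite mulrN mulr_sumr; congr (- _).
  by apply: eq_bigr => k _; rewrite mulrA.
(* Duality of [D] keeps only the term [k = l], which cancels the phase [\sum_j c j l * x j]. *)
rewrite sumrN exchange_big /= (bigD1 l) //= -mulr_suml DP eqxx mul1r.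
rewrite [X in - (_ + X)]big1 ?addr0 ?subrr // => k kl.
by rewrite -mulr_suml DP eq_sym (negPf kl) mul0r.
Qed.

End Kernel.

(** A simplex with [n] vertices exhausts a whole Z-basis [w]. Expanding the standard vectors in [w]
    gives [D], extended by zero to the remaining vertices. *)
Lemma nonsingular_dual (R : realType) (m n : nat) (Sigma : {set {set 'I_m}})
    (v : 'I_m -> 'I_n -> int) :
  simplicial_complex_dim n Sigma -> nonsingular_fan Sigma v ->
  exists D : 'I_m -> 'I_n -> R,
    forall l k, \sum_i (v i l)%:~R * D i k = (l == k)%:R.
Proof.
move=> [_ _ _ _ [I [IS In]]] /(_ _ IS)[w [[wspan _] [f [finj wf]]]].
have /boolp.choice[a aP] (k : 'I_n) : exists a : 'I_n -> int,
    forall l, (l == k)%:R = \sum_j a j * w j l by exact: wspan.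
have fI : f @: I = [set: 'I_n]%SET.
  by apply/eqP; rewrite eqEcard finset.subsetT cardsT card_ord (card_in_imset finj) In leqnn.
exists (fun i k => if i \in I then (a k (f i))%:~R else 0) => l k.
rewrite (bigID (mem I)) /= [X in _ + X]big1 ?addr0 => [|i /negPf->]; last first.
  by rewrite mulr0.
have -> : (l == k)%:R = ((l == k)%:R : int)%:~R :> R by rewrite mulrz_nat.
rewrite aP raddf_sum /=.
transitivity (\sum_(j in f @: I) (a k j * w j l)%:~R : R); last first.
  by apply: eq_bigl => j; rewrite fI finset.in_setT.
rewrite big_imset //=; apply: eq_bigr => i iI.
by rewrite iI wf // intrM mulrC.
Qed.

(** * Limits of complex-valued functions along a filter *)

Section ComplexLimits.
Variables (R : realType) (X : Type) (F : set_system X).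
Context {FF : Filter F}.
Implicit Types (f g : X -> R[i]).

Definition ccvg f (l : R[i]) : Prop :=
  complex.Re (f x) @[x --> F] --> complex.Re l /\
  complex.Im (f x) @[x --> F] --> complex.Im l.

Lemma ccvg_cabs f l : ccvg f l -> cabs (f x) @[x --> F] --> cabs l.
Proof.
move=> [fr fi]; rewrite /cabs.
apply: (@continuous_cvg _ _ _ _ _
  (fun x => complex.Re (f x) ^+ 2 + complex.Im (f x) ^+ 2) Num.sqrt).
  exact: sqrt_continuous.
by rewrite !expr2; under eq_cvg do rewrite !expr2; apply: cvgD; apply: cvgM.
Qed.

Lemma ccvgM f g k l : ccvg f k -> ccvg g l -> ccvg (fun x => f x * g x) (k * l).
Proof.
have ReM (a b : R[i]) : complex.Re (a * b) =
  complex.Re a * complex.Re b - complex.Im a * complex.Im b by case: a; case: b.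
have ImM (a b : R[i]) : complex.Im (a * b) =
  complex.Re a * complex.Im b + complex.Im a * complex.Re b by case: a; case: b.
move=> [fr fi] [gr gi]; split.
  rewrite ReM; under eq_cvg do rewrite ReM.
  by apply: cvgB; apply: cvgM.
rewrite ImM; under eq_cvg do rewrite ImM.
by apply: cvgD; apply: cvgM.
Qed.

Lemma ccvg_polar (x theta : X -> R) x0 theta0 :
  x t @[t --> F] --> x0 -> theta t @[t --> F] --> theta0 ->
  ccvg (fun t => polar (x t) (theta t)) (polar x0 theta0).
Proof.
move=> xc tc; split; apply: cvgM; apply: continuous_cvg => //.
- exact: continuous_expR.
- exact: continuous_cos.
- exact: continuous_expR.
- exact: continuous_sin.
Qed.

Lemma ccvg_dist_lt f l e : ccvg f l -> 0 < e -> \forall x \near F, cabs (f x - l) < e.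
Proof.
move=> [fr fi] e0; have ReB (a b : R[i]) : complex.Re (a - b) =
  complex.Re a - complex.Re b by case: a; case: b.
have ImB (a b : R[i]) : complex.Im (a - b) =
  complex.Im a - complex.Im b by case: a; case: b.
have cr : complex.Re (f x) - complex.Re l @[x --> F] --> complex.Re l - complex.Re l.
  by apply: cvgB => //; exact: cvg_cst.
have ci : complex.Im (f x) - complex.Im l @[x --> F] --> complex.Im l - complex.Im l.
  by apply: cvgB => //; exact: cvg_cst.
rewrite subrr in cr; rewrite subrr in ci.
have /ccvg_cabs dl : ccvg (fun x => f x - l) 0.
  by split; [under eq_cvg do rewrite ReB|under eq_cvg do rewrite ImB].
by apply: cvgr_lt dl _ _; rewrite cabs0.
Qed.

End ComplexLimits.

(** * Neighbourhoods relative to a subset of C^m *)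

Section RelativeNeighbourhoods.
Variables (R : realType) (m : nat).
Implicit Types (U S : set ('I_m -> R[i])) (z w : 'I_m -> R[i]).

(** [open_in_C U S] says exactly that [S] belongs to this filter at each of its points. *)
Definition rel_nbhs U z : set_system ('I_m -> R[i]) :=
  [set S | exists e : R, 0 < e /\
     forall w, U w -> (forall i, cabs (w i - z i) < e) -> S w].

#[global] Instance rel_nbhs_filter U z : Filter (rel_nbhs U z).
Proof.
split=> [|S S' [e [e0 eS]] [e' [e'0 eS']]|S S' SS' [e [e0 eS]]].
- by exists 1.
- exists (Num.min e e'); split=> [|w Uw we]; first by rewrite lt_min e0.
  by split; [apply: eS|apply: eS'] => // i; move: (we i); rewrite lt_min => /andP[].
- by exists e; split=> // w Uw we; apply: SS'; exact: eS.
Qed.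

Lemma rel_nbhs_singleton U S z : U z -> rel_nbhs U z S -> S z.
Proof.
by move=> Uz [e [e0 eS]]; apply: eS => // i; rewrite subrr cabs0.
Qed.

Lemma rel_nbhs_ccvg U z i : ccvg (rel_nbhs U z) (fun w => w i) (z i).
Proof.
split; apply/cvgrPdist_lt => e e0; exists e; split=> // w _ /(_ i); apply: le_lt_trans.
  rewrite distrC (_ : _ - _ = complex.Re (w i - z i)) ?normr_Re_le_cabs //.
  by case: (w i); case: (z i).
rewrite distrC (_ : _ - _ = complex.Im (w i - z i)) ?normr_Im_le_cabs //.
by case: (w i); case: (z i).
Qed.

End RelativeNeighbourhoods.

(* The polyhedral product of the pairs (closed disc, circle) over Sigma. *)
Definition moment_angle (R : realType) (m : nat) (Sigma : {set {set 'I_m}}) :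
    set ('I_m -> R[i]) :=
  [set z | (forall i, cabs (z i) <= 1) /\
     exists2 I, I \in Sigma & forall i, i \notin I -> cabs (z i) = 1].

Lemma moment_angle_Uset (R : realType) (m : nat) (Sigma : {set {set 'I_m}}) :
  @moment_angle R m Sigma `<=` @Uset R m Sigma.
Proof.
move=> z [_ [I IS zI]]; exists I; split=> // i /zI zi.
by rewrite -cabs_gt0 zi ltr01.
Qed.

Lemma moment_angle_unitary (R : realType) (m : nat) (Sigma : {set {set 'I_m}})
    (h z : 'I_m -> R[i]) : (forall i, cabs (h i) = 1) ->
  moment_angle Sigma z -> moment_angle Sigma (fun i => h i * z i).
Proof.
move=> h1 [z1 [I IS zI]]; split=> [i|]; first by rewrite cabsM h1 mul1r.
by exists I => // i iI; rewrite cabsM h1 mul1r zI.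
Qed.

(** * Orbits of ker lambda and the moment-angle complex *)

Section MomentAngle.
Variables (R : realType) (m n : nat) (Sigma : {set {set 'I_m}}).
Variables (b c : 'I_m -> 'I_n -> R) (v : 'I_m -> 'I_n -> int).
Hypothesis fanP : complete_nonsingular_fan Sigma b c v.
Implicit Types (h z w : 'I_m -> R[i]).

Local Notation Z := (@moment_angle R m Sigma).
Local Notation U := (@Uset R m Sigma).

Lemma fan_coord_unique p s t : fan_coord Sigma b p s -> fan_coord Sigma b p t ->
  forall i, s i = t i.
Proof. by have [[_ indep coneI _ _] _ _] := fanP; exact: fan_coord_uniq. Qed.

(* Where z_i = 0, log |h_i| is split into positive and negative parts, so that both
   coordinate vectors stay nonnegative; elsewhere they are -log |z_i| and -log |w_i|. *)
Lemma moment_angle_log_rigid h z : Z z -> Z (fun i => h i * z i) ->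
  (forall i, h i != 0) -> (forall k, \sum_i ln (cabs (h i)) * b i k = 0) ->
  forall i, cabs (h i) = 1.
Proof.
move=> [z1 [I IS zI]] [w1 [J JS wJ]] h0 hL.
pose w i := h i * z i.
pose x i := ln (cabs (h i)).
pose s i := if z i == 0 then Num.max (x i) 0 else - ln (cabs (z i)).
pose t i := if z i == 0 then Num.max (- x i) 0 else - ln (cabs (w i)).
have xE i : x i = s i - t i.
  rewrite /s /t; case: (eqVneq (z i) 0) => [_|zi].
    by rewrite /Num.max oppr_lt0; by case: ltgtP => [_|_|->]; ring.
  by rewrite /w cabsM lnM ?posrE ?cabs_gt0 // -/(x i); ring.
have sP : fan_coord Sigma b (fun k => \sum_i s i * b i k) s.
  split=> // [i|].
    rewrite /s; case: ifP => _; first by rewrite le_max lexx orbT.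
    by rewrite oppr_ge0 ln_le0.
  exists I => // i iI; have /negPf zi : z i != 0 by rewrite -cabs_gt0 zI ?ltr01.
  by rewrite /s zi zI // ln1 oppr0.
(* Since [s - t = x] and [x] is a linear relation among the [b i], the vector [t] represents the
   same point as [s]; uniqueness then forces [x = 0]. *)
have tP : fan_coord Sigma b (fun k => \sum_i s i * b i k) t.
  split=> [i||k].
  - rewrite /t; case: ifP => _; first by rewrite le_max lexx orbT.
    by rewrite oppr_ge0; apply: ln_le0; exact: w1.
  - exists J => // i iJ; rewrite /t; have wi := wJ i iJ.
    have : w i != 0 by rewrite -cabs_gt0 wi ltr01.
    by rewrite mulf_eq0 negb_or => /andP[_ /negPf->]; rewrite wi ln1 oppr0.
  - apply/eqP; rewrite -subr_eq0 -sumrB; apply/eqP; rewrite -[RHS](hL k).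
    by apply: eq_bigr => i _; rewrite -mulrBl -xE.
move=> i; apply/eqP; rewrite -ln_eq0 ?cabs_gt0 // -/(x i) xE.
by rewrite (fan_coord_unique sP tP) subrr.
Qed.

Lemma orbit_moment_angle z w : Z z -> Z w -> orbit b c v z w ->
  exists h, [/\ forall i, cabs (h i) = 1, forall k, lam b c v h k = 1
    & w = (fun i => h i * z i)].
Proof.
move=> Zz Zw [h [hK wE]]; have {}wE : w = (fun i => h i * z i) by exact/funext.
exists h; split=> //; last by have [] := hK.
rewrite wE in Zw; apply: (moment_angle_log_rigid Zz Zw); last exact: kerlam_log hK.
by have [] := hK.
Qed.

(** Serves equivariance: an [h] lying over the compact torus need not have moduli 1. Its log-moduli
    form a relation among the [b i], so some kernel element [g] has the same moduli, and [u] is the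
    quotient. *)
Lemma unitary_decomposition h : (forall i, h i != 0) ->
  (forall k, cabs (lam b c v h k) = 1) ->
  exists g u, [/\ kerlam b c v g, forall i, cabs (u i) = 1,
    h = (fun i => g i * u i) & lam b c v u = lam b c v h].
Proof.
move=> h0 h1; have [[simp _ _ _ _] _ nons] := fanP.
have [D DP] := nonsingular_dual R simp nons.
have gK := kerlam_phase c DP (lam_unitary_log h0 h1).
set g := (fun i => _) in gK.
have g0 : forall i, g i != 0 by have [] := gK.
have hE : h = (fun i => g i * (h i / g i)) by apply/funext => i; rewrite mulrC divfK.
have u0 i : h i / g i != 0 by rewrite mulf_neq0 ?invr_eq0.
exists g, (fun i => h i / g i); split=> // [i|].
  by rewrite cabsM cabsV cabs_polar lnK ?posrE ?cabs_gt0 // divff // cabs_eq0.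
apply/funext => k; rewrite [in RHS]hE [RHS]lamM //.
by have [_ ->] := gK; rewrite mul1r.
Qed.

(* Coordinates vanishing at z0 enter the retraction only through the constant N:
   this makes it continuous up to the strata where further coordinates vanish. *)
Lemma local_retraction z0 : U z0 ->
  exists rho : ('I_m -> R[i]) -> 'I_m -> R[i],
    (forall i, ccvg (rel_nbhs U z0) (fun w => rho w i) (rho z0 i)) /\
    \forall w \near rel_nbhs U z0, Z (rho w) /\ orbit b c v w (rho w).
Proof.
move=> Uz0; have [[simp indep coneI _ _] compl nons] := fanP.
have [D DP] := nonsingular_dual R simp nons.
have [T TP] := complete_fan_coord compl.
pose I := [set i | z0 i == 0]%SET.
have IS : I \in Sigma.
  have [J [JS z0J]] := Uz0; have [_ sub _ _ _] := simp.
  apply: sub JS _; apply/fintype.subsetP => i; rewrite inE; apply: contraLR; exact: z0J.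
pose q0 w k := \sum_(i in ~: I) - ln (cabs (w i)) * b i k.
(* Positivity on [I] at [z0] persists nearby, so the simplex supporting [T (q w)] will contain [I];
   off that simplex [rho w] then has modulus exactly 1. *)
have [N NP] := fan_coord_star indep coneI (q0 z0) TP IS.
pose q w k := q0 w k + N * \sum_(j in I) b j k.
(* Both terms of the difference are coefficient vectors of the same point [q w], so [x w] is a
   relation among the [b i] and hence the log-moduli of a kernel element. *)
pose x w i := (if i \in I then N else - ln (cabs (w i))) - T (q w) i.
pose rho w i := polar (x w i) (- \sum_k D i k * \sum_j c j k * x w j) * w i.
pose F := rel_nbhs U z0; have FF : Filter F by exact: rel_nbhs_filter.
have absF i : cabs (w i) @[w --> F] --> cabs (z0 i).
  by apply: ccvg_cabs; exact: rel_nbhs_ccvg.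
have lnF i : i \notin I -> - ln (cabs (w i)) @[w --> F] --> - ln (cabs (z0 i)).
  rewrite inE => z0i; apply: cvgN; apply: continuous_cvg => //.
  by apply: continuous_ln; rewrite cabs_gt0.
have qF k : q w k @[w --> F] --> q z0 k.
  apply: cvgD; last exact: cvg_cst.
  apply: cvgr_sum => i; rewrite finset.in_setC => iI; apply: cvgM; last exact: cvg_cst.
  exact: lnF.
have TF i : T (q w) i @[w --> F] --> T (q z0) i by exact: (fan_coord_cvg indep coneI TP qF).
have xF i : x w i @[w --> F] --> x z0 i.
  apply: cvgB => //; case: ifPn => iI; [exact: cvg_cst|exact: lnF].
exists rho; split=> [i|].
  apply: ccvgM; last exact: rel_nbhs_ccvg.
  apply: ccvg_polar => //; apply: cvgN; apply: cvgr_sum => k _.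
  apply: cvgM; first exact: cvg_cst.
  by apply: cvgr_sum => j _; apply: cvgM => //; exact: cvg_cst.
have x0 w k : \sum_i x w i * b i k = 0.
  rewrite (eq_bigr (fun i => (if i \in I then N else - ln (cabs (w i))) * b i k
    - T (q w) i * b i k)); last by move=> i _; rewrite mulrBl.
  rewrite sumrB; have [_ _ <-] := TP (q w).
  rewrite (bigID (mem I)) /= /q /q0 mulr_sumr.
  rewrite (eq_bigr (fun i => N * b i k)) => [|i ->] //.
  rewrite [X in _ + X - _](eq_bigr (fun i => - ln (cabs (w i)) * b i k)); last first.
    by move=> i /negPf->.
  rewrite [X in _ + X - _](eq_bigl (mem (~: I)%SET)) => [|i]; last by rewrite /= !inE.
  by apply/eqP; rewrite subr_eq0 addrC.
have orb w : orbit b c v w (rho w).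
  by eexists; split; first exact: (kerlam_phase c DP (x0 w)).
have near1 i : \forall w \near F, i \in I -> 0 < T (q w) i.
  have [iI|_] := boolP (i \in I); last by near=> w.
  have : \forall w \near F, 0 < T (q w) i by exact: cvgr_gt (TF i) _ (NP i iI).
  exact: filterS.
(* On [I] the modulus of [rho w i] is [expR (N - T (q w) i) * cabs (w i)]; this bound on
   [cabs (w i)] keeps it at most 1. *)
have near2 i : \forall w \near F, i \in I -> cabs (w i) < expR (- N).
  have [iI|_] := boolP (i \in I); last by near=> w.
  have : \forall w \near F, cabs (w i) < expR (- N).
    apply: cvgr_lt (absF i) _ _.
    by move: iI; rewrite inE => /eqP->; rewrite cabs0 expR_gt0.
  exact: filterS.
have near3 i : \forall w \near F, i \notin I -> 0 < cabs (w i).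
  have [_|] := boolP (i \in I); first by near=> w.
  rewrite inE => z0i; have : \forall w \near F, 0 < cabs (w i).
    by apply: cvgr_gt (absF i) _ _; rewrite cabs_gt0.
  exact: filterS.
apply: filterS (filterI (filter_forall FF near1)
  (filterI (filter_forall FF near2) (filter_forall FF near3))) => w [Tpos [wI wnI]].
split; last exact: orb.
have [Tge [J JS TJ] _] := TP (q w).
have rhoI i : i \notin I -> cabs (rho w i) = expR (- T (q w) i).
  move=> iI; rewrite cabsM cabs_polar /x (negPf iI) addrC expRD.
  by rewrite -mulrA (expRN (ln _)) lnK ?posrE ?wnI // mulVf ?mulr1 // gt_eqF // wnI.
split=> [i|].
  have [iI|iI] := boolP (i \in I); last by rewrite rhoI // -expR0 ler_expR oppr_le0.
  rewrite cabsM cabs_polar /x iI; apply: (@le_trans _ _ (expR (N - T (q w) i) * expR (- N))).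
    by rewrite ler_wpM2l ?expR_ge0 // ltW // wI.
  by rewrite -expRD -expR0 ler_expR addrAC subrr add0r oppr_le0.
exists J => // i iJ; have iI : i \notin I.
  by apply/negP => /Tpos; rewrite TJ // ltxx.
by rewrite rhoI // TJ // oppr0 expR0.
Unshelve. all: by end_near. Qed.

(** The local retraction based at [z] is valid at [z] itself. *)
Lemma orbit_meets_moment_angle z : U z -> exists2 w, Z w & orbit b c v z w.
Proof.
move=> Uz; have [rho [_ /(rel_nbhs_singleton Uz)[Zr zr]]] := local_retraction Uz.
by exists (rho z).
Qed.

(** From [U] to [Z] one restricts. Conversely, the local retraction is continuous and moves points
    within their orbits, so it pulls a neighbourhood in [Z] back to one in [U]. *)
Lemma saturated_open S : S `<=` U ->
  (forall z w, S z -> orbit b c v z w -> S w) ->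
  open_in_C U S <-> open_in_C Z (S `&` Z).
Proof.
move=> SU sat; split=> [openS z [Sz Zz]|openS z Sz].
  have [e [e0 eS]] := openS z Sz; exists e; split=> // w Zw zw.
  by split=> //; apply: eS => //; exact: moment_angle_Uset.
have Uz := SU _ Sz; have [rho [rhoF rhoZ]] := local_retraction Uz.
have [Zr zr] := rel_nbhs_singleton Uz rhoZ.
have [e [e0 eS]] := openS (rho z) (conj (sat _ _ Sz zr) Zr).
have rhoe : \forall w \near rel_nbhs U z, forall i, cabs (rho w i - rho z i) < e.
  by apply: filter_forall => i; exact: ccvg_dist_lt.
suff : rel_nbhs U z S by [].
apply: filterS (filterI rhoZ rhoe) => w [[Zw ww] we].
have [Sw _] := eS _ Zw we.
exact: sat Sw (orbit_sym ww).
Qed.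

End MomentAngle.

(** * The orbit space described through the moment-angle complex *)

Section Quotient.
Variables (R : realType) (m n : nat) (Sigma : {set {set 'I_m}}).
Variables (b c : 'I_m -> 'I_n -> R) (v : 'I_m -> 'I_n -> int).
Hypothesis fanP : complete_nonsingular_fan Sigma b c v.
Implicit Types (z w : 'I_m -> R[i]) (O : set ('I_m -> R[i])).

Local Notation Z := (@moment_angle R m Sigma).
Local Notation U := (@Uset R m Sigma).
Local Notation X := (Xspace Sigma b c v).

Lemma Xspace_moment_angle O : X O -> exists2 z, Z z & O = orbit b c v z.
Proof.
move=> [z [Uz ->]]; have [w Zw zw] := orbit_meets_moment_angle fanP Uz.
by exists w => //; exact: orbit_eq.
Qed.

Lemma orbit_Xspace z : Z z -> X (orbit b c v z).
Proof. by move=> Zz; exists z; split=> //; exact: moment_angle_Uset. Qed.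

Lemma Xspace_mem O z : X O -> O z -> O = orbit b c v z.
Proof. by move=> [w [_ ->]]; exact: orbit_eq. Qed.

Lemma orbit_Uset z w : U z -> orbit b c v z w -> U w.
Proof.
move=> [I [IS zI]] [h [[h0 _] wE]]; exists I; split=> // i iI.
by rewrite wE mulf_neq0 ?zI.
Qed.

(** Reduces the quotient topology to traces on [Z], a space common to all fans over [Sigma]. *)
Lemma Xopen_moment_angle (A : set (set ('I_m -> R[i]))) : A `<=` X ->
  Xopen Sigma A <-> open_in_C Z ((\bigcup_(O in A) O) `&` Z).
Proof.
move=> AX; apply: (saturated_open fanP) => [z [O AO Oz]|z w [O AO Oz] zw].
  by have [y [Uy OE]] := AX _ AO; rewrite OE in Oz; exact: orbit_Uset Oz.
by exists O => //; rewrite (Xspace_mem (AX _ AO) Oz).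
Qed.

End Quotient.

(** * Comparison of two fans with the same integer vectors *)

Section ChangeOfFan.
Variables (R : realType) (m n : nat) (Sigma : {set {set 'I_m}}).
Variables (b c b' c' : 'I_m -> 'I_n -> R) (v : 'I_m -> 'I_n -> int).
Hypothesis fanP : complete_nonsingular_fan Sigma b c v.
Implicit Types (h z w : 'I_m -> R[i]).

Local Notation Z := (@moment_angle R m Sigma).

Lemma lam_unitary h : (forall i, cabs (h i) = 1) -> lam b c v h = lam b' c' v h.
Proof.
by move=> h1; apply/funext => k; apply: eq_bigr => i _; exact: cpow_unit.
Qed.

(** The element joining two points of [Z] has all moduli 1, where lambda does not see [b] and [c],
    so it lies in both kernels. *)
Lemma orbit_change_fan z w : Z z -> Z w -> orbit b c v z w -> orbit b' c' v z w.
Proof.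
move=> Zz Zw /(orbit_moment_angle fanP Zz Zw)[h [h1 hK ->]].
exists h; split=> //; split=> [|k]; first exact: cabs_unitary_neq0.
by rewrite -lam_unitary.
Qed.

End ChangeOfFan.

(** * The homeomorphism of orbit spaces and its equivariance *)

Theorem theorem7p2 (R : realType) (m n : nat) (Sigma : {set {set 'I_m}})
    (b c b' c' : 'I_m -> 'I_n -> R) (v v' : 'I_m -> 'I_n -> int) :
  complete_nonsingular_fan Sigma b c v ->
  complete_nonsingular_fan Sigma b' c' v' ->
  (forall i k, v i k = v' i k) ->
  exists F : set ('I_m -> R[i]) -> set ('I_m -> R[i]),
    [/\ set_bij (Xspace Sigma b c v) (Xspace Sigma b' c' v') F,
        (forall A, A `<=` Xspace Sigma b c v ->
           (Xopen Sigma A <-> Xopen Sigma (F @` A)))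
      & (forall t, @torus R n t -> forall x y, Xspace Sigma b c v x ->
           Xact b c v t x y -> Xact b' c' v' t (F x) (F y))].
Proof.
move=> fanP fanP' vv'.
have {vv'} vE : v' = v by apply/funext => i; apply/funext => k.
rewrite {}vE in fanP' *.
(* [F] has to be total, so a representative is chosen for every set; sets that are not orbits
   receive the default 0. *)
have /boolp.choice[r rP] : forall O : set ('I_m -> R[i]), exists w,
    Xspace Sigma b c v O -> moment_angle Sigma w /\ O = orbit b c v w.
  move=> O; have [XO|nXO] := pselect (Xspace Sigma b c v O); last by exists (fun=> 0).
  by have [w Zw OE] := Xspace_moment_angle fanP XO; exists w.
pose F O := orbit b' c' v (r O); exists F.
(* The value is independent of the chosen representative: two representatives in the moment-angle
   complex share an orbit of the second fan too. *)
have FE z : moment_angle Sigma z -> F (orbit b c v z) = orbit b' c' v z.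
  move=> Zz; have [Zr zr] := rP _ (orbit_Xspace b c v Zz).
  apply: orbit_eq; apply: (orbit_change_fan _ _ fanP) => //.
  by rewrite -zr; exact: orbit_refl.
have FX O : Xspace Sigma b c v O -> Xspace Sigma b' c' v (F O).
  by move=> /(Xspace_moment_angle fanP)[z Zz ->]; rewrite FE //; exact: orbit_Xspace.
split.
- split=> //.
  + move=> O1 O2 /set_mem/(Xspace_moment_angle fanP)[z1 Zz1 ->].
    move=> /set_mem/(Xspace_moment_angle fanP)[z2 Zz2 ->].
    rewrite !FE // => E; apply: orbit_eq.
    by apply: (orbit_change_fan _ _ fanP') => //; rewrite E; exact: orbit_refl.
  + move=> O /(Xspace_moment_angle fanP')[z Zz ->].
    by exists (orbit b c v z); [exact: orbit_Xspace|exact: FE].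
- move=> A AX; rewrite (Xopen_moment_angle fanP AX) (Xopen_moment_angle fanP'); last first.
    by move=> _ [O AO <-]; exact/FX/AX.
  (* Both conditions concern traces on the moment-angle complex, and [F] preserves the trace of each
     orbit. *)
  suff -> : (\bigcup_(O in A) O) `&` @moment_angle R m Sigma =
      (\bigcup_(O in F @` A) O) `&` @moment_angle R m Sigma by [].
  apply/seteqP; split=> z [].
    move=> [O AO Oz] Zz; split=> //; exists (F O); first by exists O.
    by rewrite (Xspace_mem (AX _ AO) Oz) FE //; exact: orbit_refl.
  move=> [_ [O AO <-] FOz] Zz; split=> //; exists O => //.
  have [w Zw OE] := Xspace_moment_angle fanP (AX _ AO).
  rewrite OE FE // in FOz; rewrite OE.
  exact: (orbit_change_fan _ _ fanP').
- move=> t t1 x y Xx [z [h [xz [h0 [ht ->]]]]].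
  (* Here [z] may lie outside the moment-angle complex and [h] may have moduli other than 1. Moving
     [z] to [w] along its orbit and absorbing [g] into the kernel makes [y] the orbit of
     [u i * w i], a point of the moment-angle complex, where [FE] applies. *)
  have [w Zw xE] := Xspace_moment_angle fanP Xx.
  have zw : orbit b c v z w by rewrite -(Xspace_mem Xx xz) xE; exact: orbit_refl.
  have h1 k : cabs (lam b c v h k) = 1 by rewrite ht; exact: t1.
  have [g [u [gK u1 hE uh]]] := unitary_decomposition fanP h0 h1.
  have Zuw := moment_angle_unitary u1 Zw.
  have yE : orbit b c v (fun i => h i * z i) = orbit b c v (fun i => u i * w i).
    rewrite (orbit_mul _ zw); apply/esym/orbit_eq; exists g; split=> // i.
    by rewrite hE mulrA.
  exists w, u; split; [|split; [|split]].
  + by rewrite xE FE //; exact: orbit_refl.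
  + exact: cabs_unitary_neq0.
  + by move=> k; rewrite -(lam_unitary b c) // uh.
  + by rewrite yE FE.
Qed.
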